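(* Fix $0<\beta<1$ and $\mu>0$. For all $v_0\in\mathbb{R}^m$, the Newton iterations $v_{i+1} = v_i+\frac{1}{\alpha_i}d(v_i,\mu)$ with step-size rule $\alpha_i = \max\{1,\frac{1}{2\beta}\|d(v_i,\mu)\|_\infty^2\}$ converge to the centered point $\hat v(\mu)$.
   Context: Data and standing assumptions: $A\in\mathbb{R}^{m\times n}$, $b\in\mathbb{R}^m$, $c\in\mathbb{R}^n$, and $W\in\mathbb{R}^{n\times n}$ is symmetric positive semidefinite. It is assumed that (i) there exists $x\in\mathbb{R}^n$ with $Ax+b>0$ (componentwise); (ii) for every $\gamma\in\mathbb{R}$ the set $\{x\in\mathbb{R}^n: \frac12 x^TWx + c^Tx\le\gamma,\ Ax+b\ge0\}$ is bounded; (iii) $A^TA+W$ is positive definite. Notation: $\circ$ is the elementwise product, $e^v$ is the elementwise exponential. Centered point: for $\mu>0$, $\hat v(\mu)$ is the unique $v\in\mathbb{R}^m$ such that, for some $x\in\mathbb{R}^n$, $\sqrt\mu A^Te^v = Wx+c$ and $\sqrt\mu e^{-v} = Ax+b$. (It exists and is unique under the standing assumptions.) Newton direction: for $v\in\mathbb{R}^m$ and $\mu>0$, $d(v,\mu)\in\mathbb{R}^m$ is the (unique) $d$ that, together with a (unique) $x\in\mathbb{R}^n$, satisfies $\sqrt\mu A^T(e^v+e^v\circ d) = Wx+c$ and $\sqrt\mu(e^{-v}-e^{-v}\circ d) = Ax+b$. *)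

(* Defs.v *)
From HB Require Import structures.
From mathcomp Require Import all_boot all_order all_algebra.
From mathcomp Require Import all_classical all_reals all_analysis.

Set Implicit Arguments.
Unset Strict Implicit.
Unset Printing Implicit Defensive.
Import Order.TTheory GRing.Theory Num.Theory.
Import numFieldNormedType.Exports.

Local Open Scope classical_set_scope.
Local Open Scope ring_scope.

Section Matrices.
Context {R : realType}.

Definition quadform n (M : 'M[R]_n) (x : 'cV[R]_n) : R := (x^T *m M *m x) 0 0.

Definition psd n (M : 'M[R]_n) : Prop :=
  M^T = M /\ forall x : 'cV[R]_n, 0 <= quadform M x.

Definition posdef n (M : 'M[R]_n) : Prop :=
  M^T = M /\ forall x : 'cV[R]_n, x != 0 -> 0 < quadform M x.

Definition expv m (v : 'cV[R]_m) : 'cV[R]_m := map_mx expR v.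

Definition hadamard m (u v : 'cV[R]_m) : 'cV[R]_m := map2_mx *%R u v.

End Matrices.

Section CenteringAndNewton.
Context {R : realType} {m n : nat}.
Variables (A : 'M[R]_(m, n)) (b : 'cV[R]_m) (c : 'cV[R]_n) (W : 'M[R]_n).

Definition strictly_feasible : set 'cV[R]_n :=
  [set x | forall i, 0 < (A *m x + b) i 0].

Definition qp_sublevel (gamma : R) : set 'cV[R]_n :=
  [set x | 2^-1 * quadform W x + (c^T *m x) 0 0 <= gamma /\
           forall i, 0 <= (A *m x + b) i 0].

Definition is_centered (mu : R) (v : 'cV[R]_m) : Prop :=
  exists x : 'cV[R]_n,
    Num.sqrt mu *: (A^T *m expv v) = W *m x + c /\
    Num.sqrt mu *: expv (- v) = A *m x + b.

Definition is_newton_dir (mu : R) (v d : 'cV[R]_m) : Prop :=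
  exists x : 'cV[R]_n,
    Num.sqrt mu *: (A^T *m (expv v + hadamard (expv v) d)) = W *m x + c /\
    Num.sqrt mu *: (expv (- v) - hadamard (expv (- v)) d) = A *m x + b.

(* [xget 0 P] is the element satisfying [P] when there is one; existence and
   uniqueness hold under the assumptions of the theorem, so the default value
   0 is never used there. *)
Definition centered_point (mu : R) : 'cV[R]_m := xget 0 (is_centered mu).

Definition newton_dir (v : 'cV[R]_m) (mu : R) : 'cV[R]_m :=
  xget 0 (is_newton_dir mu v).

(* The norm of a column vector is the sup norm [mx_norm]. *)
Definition newton_damping (beta mu : R) (v : 'cV[R]_m) : R :=
  Num.max 1 ((2 * beta)^-1 * `|newton_dir v mu| ^+ 2).

Definition newton_step (beta mu : R) (v : 'cV[R]_m) : 'cV[R]_m :=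
  v + (newton_damping beta mu v)^-1 *: newton_dir v mu.

Definition newton_iterates (beta mu : R) (v0 : 'cV[R]_m) (i : nat) : 'cV[R]_m :=
  iter i (newton_step beta mu) v0.

End CenteringAndNewton.

(* Main.v *)
Require Import Defs.
From HB Require Import structures.
From mathcomp Require Import all_boot all_order all_algebra.
From mathcomp Require Import all_classical all_reals all_analysis.
From mathcomp Require Import ring lra.

Set Implicit Arguments.
Unset Strict Implicit.
Unset Printing Implicit Defensive.

Import Order.TTheory GRing.Theory Num.Theory.
Import numFieldNormedType.Exports.
Local Open Scope classical_set_scope.
Local Open Scope ring_scope.

(* With w := v - vhat, the potential G := sum_i (2 cosh w_i - 2) vanishes only
   at the centered point vhat.  Subtracting the centering equations from the
   Newton equations and pairing them, positive semidefiniteness of W yields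
     sum_i 2 sinh(w_i) d_i <= - G - |d|_2^2,
   so d is a descent direction for G.  Along s |-> w + s d the potential phi
   satisfies phi'' <= |d|_oo^2 phi + 2 |d|_2^2, and this turns the step-size
   rule into G(v + d / alpha) <= (1 - (1 - beta) / alpha) G(v).  The displayed
   inequality also bounds d in terms of G, so alpha stays bounded along the
   iteration and the decrease of G is geometric.

   The centered point is obtained from a minimizer of the logarithmic barrier
   function, or rather from a maximizer of exp(- q / mu) prod_i (A x + b)_i,
   which has no singularity on the boundary of the feasible set. *)

(** * The potential along a damped Newton step *)

Lemma quadratic_upper_bound (R : realType) (f f1 f2 : R -> R) (p K : R) :
  0 <= p -> (forall x : R, is_derive x 1 f (f1 x)) ->
  (forall x : R, is_derive x 1 f1 (f2 x)) ->
  (forall x : R, 0 <= x <= p -> f2 x <= K) ->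
  f p <= f 0 + p * f1 0 + p ^+ 2 * K / 2.
Proof.
move=> p0 df df1 f2K.
have cont (g g' : R -> R) :
    (forall x : R, is_derive x 1 g (g' x)) -> continuous g.
  move=> dg x; apply: differentiable_continuous; apply/derivable1_diffP.
  exact: ex_derive.
have f1K (x : R) : 0 <= x <= p -> f1 x <= f1 0 + K * x.
  move=> /andP[x0 xp].
  have [|c cx] := @MVT_segment R f1 f2 0 x x0 (fun y _ => df1 y).
    exact/continuous_subspaceT/(cont _ _ df1).
  rewrite subr0 => fE; move: cx; rewrite in_itv/= => /andP[c0 cx].
  rewrite -lerBlDl fE; apply: ler_wpM2r => //; apply: f2K.
  by rewrite c0 (le_trans cx).
(* Subtracting the antiderivative of the bound [f1K] leaves a function whose derivative is
   nonpositive on [0, p]. *)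
pose h (x : R) := f x - (f1 0 * x + K / 2 * x ^+ 2).
pose h1 (x : R) := f1 x - (f1 0 + K * x).
have dh (x : R) : is_derive x 1 h (h1 x).
  rewrite /h /h1; apply: is_derive_eq.
  by rewrite /GRing.scale/=; field.
have [|c cx] := @MVT_segment R h h1 0 p p0 (fun y _ => dh y).
  exact/continuous_subspaceT/(cont _ _ dh).
move: cx; rewrite in_itv/= => cp.
have : h1 c * (p - 0) <= 0.
  by rewrite subr0 mulr_le0_ge0// /h1 subr_le0; exact: f1K.
move=> + hE; rewrite -hE /h; lra.
Qed.

(* Let M be the maximum of f on [0, T], attained at p.  The quadratic upper
   bound at p gives M (1 - p beta) <= f 0 (1 - p), whence M <= f 0; the same
   bound at T, with f <= f 0 inserted in f2, then gives the claim. *)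
Lemma damped_descent (R : realType) (f f1 f2 : R -> R) (D E beta T : R) :
  (forall x : R, is_derive x 1 f (f1 x)) ->
  (forall x : R, is_derive x 1 f1 (f2 x)) ->
  (forall x, f2 x <= D * f x + 2 * E) -> f1 0 <= - f 0 - E ->
  0 <= f 0 -> 0 <= D -> 0 <= E -> 0 <= T <= 1 -> T * D <= 2 * beta ->
  beta < 1 -> f T <= (1 - T * (1 - beta)) * f 0.
Proof.
move=> df df1 f2D f10 f0 D0 E0 /andP[T0 T1] TD beta1.
(* Since p D <= T D <= 2 beta, the D M term costs at most p beta M, and p^2 E <= p E is cancelled by
   the - E in the slope at 0. *)
have bound M p : 0 <= M -> 0 <= p <= T ->
    (forall x : R, 0 <= x <= p -> f x <= M) ->
    f p <= f 0 - p * f 0 + p * beta * M.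
  move=> M0 /andP[p0 pT] fM.
  have fp : f p <= f 0 + p * f1 0 + p ^+ 2 * (D * M + 2 * E) / 2.
    apply: (quadratic_upper_bound p0 df df1) => x xp.
    by rewrite (le_trans (f2D x))// lerD2r ler_wpM2l// fM.
  apply: (le_trans fp).
  have h1 : p * f1 0 <= p * (- f 0 - E) by rewrite ler_wpM2l.
  have h2 : p * (p * D) * M <= p * (2 * beta) * M.
    rewrite ler_wpM2r// ler_wpM2l// (le_trans _ TD)// ler_wpM2r//.
  have h3 : p * p * E <= p * E.
    by rewrite ler_wpM2r// ler_piMr// (le_trans pT).
  rewrite expr2; lra.
have cf : {within `[0, T], continuous f}.
  apply: continuous_subspaceT => x; apply: differentiable_continuous.
  by apply/derivable1_diffP; exact: ex_derive.
have [p] := EVT_max T0 cf; rewrite in_itv/= => /andP[p0 pT] fmax.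
have Mge : f 0 <= f p by apply: fmax; rewrite in_itv/= lexx T0.
have fp x : 0 <= x <= T -> f x <= f p by move=> xT; apply: fmax; rewrite in_itv.
have MleG : f p <= f 0.
  have fpB : f p <= f 0 - p * f 0 + p * beta * f p.
    apply: bound; rewrite ?p0 ?(le_trans f0)// => x /andP[x0 xp].
    by apply: fp; rewrite x0 (le_trans xp).
  have pb : p * beta <= p * 1 by rewrite ler_wpM2l// ltW.
  have : (1 - p * beta) * f p <= (1 - p * beta) * f 0.
    by have := ler_wpM2r f0 pb; lra.
  have [p00|p_neq0] := eqVneq p 0; first by rewrite p00.
  have pb1 : 0 < 1 - p * beta.
    have : p * beta < p * 1 by rewrite ltr_pM2l// lt_neqAle eq_sym p_neq0.
    have := le_trans pT T1; lra.
  by rewrite ler_pM2l.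
have : f T <= f 0 - T * f 0 + T * beta * f 0.
  by apply: bound; rewrite ?T0 ?lexx// => x xT; rewrite (le_trans (fp _ xT)).
lra.
Qed.

(** For x >= 0, square exp (x / 2) >= 1 + x / 2 and add exp (- x) >= 1 - x; the linear terms
    cancel. *)
Lemma sqr_le_cosh (R : realType) (x : R) :
  x ^+ 2 / 4 <= expR x + expR (- x) - 2.
Proof.
wlog x0 : x / 0 <= x => [H|].
  have [/H//|/ltW x0] := leP 0 x.
  by have := H (- x); rewrite oppr_ge0 sqrrN opprK [expR (- x) + _]addrC; exact.
have := expR_ge1Dx (- x); have : (1 + x / 2) ^+ 2 <= expR x.
  rewrite {2}(splitr x) expRD -expr2 lerXn2r ?nnegrE ?expR_ge0 ?expR_ge1Dx//.
  by rewrite addr_ge0 // divr_ge0.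
by rewrite !expr2; lra.
Qed.

(** The potential G: each summand is 2 cosh w_i - 2. *)
Definition divergence (R : realType) (m : nat) (w : 'cV[R]_m) : R :=
  \sum_i (expR (w i 0) + expR (- w i 0) - 2).

Lemma divergence_ge_coord (R : realType) (m : nat) (w : 'cV[R]_m) (i : 'I_m) :
  expR (w i 0) + expR (- w i 0) - 2 <= divergence w.
Proof.
rewrite /divergence (bigD1 i)//= lerDl sumr_ge0// => j _.
by apply: le_trans (sqr_le_cosh _); rewrite divr_ge0// sqr_ge0.
Qed.

Lemma divergence_ge0 (R : realType) (m : nat) (w : 'cV[R]_m) :
  0 <= divergence w.
Proof.
rewrite sumr_ge0// => j _.
by apply: le_trans (sqr_le_cosh _); rewrite divr_ge0// sqr_ge0.
Qed.

Lemma col_norm_sq_le (R : realType) (m : nat) (w : 'cV[R]_m) (B : R) : 0 <= B ->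
  (forall i, w i 0 ^+ 2 <= B) -> `|w| ^+ 2 <= B.
Proof.
(* The zero case covers m = 0, where no entry attains the norm. *)
move=> B0 wB; have [w0|/mx_norm_neq0[[i j]]] := eqVneq (mx_norm w) 0.
  by rewrite /Num.norm/= w0 expr0n.
by rewrite {2}/Num.norm/= => ->/=; rewrite (ord1 j) real_normK ?num_real.
Qed.

Lemma coord_le_norm (R : realType) (m : nat) (w : 'cV[R]_m) (i : 'I_m) :
  `|w i 0| <= `|w|.
Proof.
rewrite [leRHS]/Num.norm/= mx_normrE; apply/bigmax_geP; right => /=.
by exists (i, 0).
Qed.

Lemma newton_dir_inequality (R : realType) (m n : nat) (A : 'M[R]_(m, n))
    (b : 'cV[R]_m) (c : 'cV[R]_n) (W : 'M[R]_n) (mu : R) (v vh d : 'cV[R]_m) :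
  psd W -> 0 < mu -> is_centered A b c W mu vh ->
  is_newton_dir A b c W mu v d ->
  \sum_i ((expR ((v - vh) i 0) - expR (- (v - vh) i 0)) * d i 0) <=
  - divergence (v - vh) - \sum_i d i 0 ^+ 2.
Proof.
move=> [Wsym W0] mu0 [xh [ph qh]] [x [p q]].
set s := Num.sqrt mu in ph qh p q; have s0 : 0 < s by rewrite sqrtr_gt0.
set P := expv v + _ in p; set Q := expv (- v) - _ in q.
have dP : s *: (A^T *m (P - expv vh)) = W *m (x - xh).
  rewrite mulmxBr scalerBr p ph mulmxBr.
  by rewrite opprD addrACA subrr addr0.
have dQ : s *: (Q - expv (- vh)) = A *m (x - xh).
  by rewrite scalerBr q qh mulmxBr opprD addrACA subrr addr0.
(* By [dP] and [dQ], s^2 times this pairing is (x - xh)^T W (x - xh). *)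
have : 0 <= ((P - expv vh)^T *m (Q - expv (- vh))) 0 0.
  rewrite -(pmulr_rge0 _ s0) -(pmulr_rge0 _ s0).
  have -> : s * (s * ((P - expv vh)^T *m (Q - expv (- vh))) 0 0) =
            quadform W (x - xh); last exact: W0.
  rewrite /quadform -[(x - xh)^T *m W]trmxK trmx_mul trmxK Wsym -dP.
  rewrite linearZ/= trmx_mul trmxK -scalemxAl -mulmxA -dQ -scalemxAr.
  by rewrite [RHS]mxE [X in _ = _ * X]mxE.
rewrite mxE -subr_ge0 => H; rewrite -subr_ge0; apply: (le_trans H).
(* Termwise an equality: with a = exp v_i and e = exp vh_i, (a + a d - e) (1/a - d/a - 1/e) = 2 -
   a/e - e/a - d^2 - (a/e - e/a) d. *)
rewrite subr0 /divergence -!sumrN -!big_split/= ler_sum// => i _.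
rewrite !mxE/= !opprB !expRD !expRN.
have := expR_gt0 (v i 0); have := expR_gt0 (vh i 0).
set a := expR (v i 0); set e := expR (vh i 0); move: (d i 0) => D e0 a0.
rewrite le_eqVlt; apply/orP; left; apply/eqP; field.
by rewrite !gt_eqF.
Qed.

Lemma divergence_damped_step (R : realType) (m : nat) (w d : 'cV[R]_m)
    (beta T : R) :
  \sum_i ((expR (w i 0) - expR (- w i 0)) * d i 0) <=
    - divergence w - \sum_i d i 0 ^+ 2 ->
  0 <= T <= 1 -> T * `|d| ^+ 2 <= 2 * beta -> beta < 1 ->
  divergence (w + T *: d) <= (1 - T * (1 - beta)) * divergence w.
Proof.
move=> wd T01 Td beta1.
pose u (x : R) (i : 'I_m) : R := w i 0 + x * d i 0.
pose f (x : R) : R := \sum_i (expR (u x i) + expR (- u x i) - 2).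
pose f1 (x : R) : R := \sum_i (expR (u x i) - expR (- u x i)) * d i 0.
pose f2 (x : R) : R := \sum_i (expR (u x i) + expR (- u x i)) * d i 0 ^+ 2.
have u0 i : u 0 i = w i 0 by rewrite /u mul0r addr0.
have f0E : f 0 = divergence w by apply: eq_bigr => i _; rewrite u0.
have -> : divergence (w + T *: d) = f T.
  by apply: eq_bigr => i _; rewrite !mxE.
have df (x : R) : is_derive x 1 f (f1 x).
  have -> : f = \sum_i (fun x : R => expR (u x i) + expR (- u x i) - 2).
    by apply/funext => y; rewrite fct_sumE.
  apply: is_derive_sum => i; rewrite /u; apply: is_derive_eq.
  by rewrite /GRing.scale/=; ring.
have df1 (x : R) : is_derive x 1 f1 (f2 x).
  have -> : f1 = \sum_i (fun x : R => (expR (u x i) - expR (- u x i)) * d i 0).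
    by apply/funext => y; rewrite fct_sumE.
  apply: is_derive_sum => i; rewrite /u; apply: is_derive_eq.
  by rewrite /GRing.scale/=; ring.
rewrite -f0E.
apply: (damped_descent df df1 (D := `|d| ^+ 2) (E := \sum_i d i 0 ^+ 2)) => //.
(* Split 2 cosh u as (2 cosh u - 2) + 2: d_i^2 is replaced by the squared sup norm only in the
   first, nonnegative part. *)
- move=> x; rewrite /f2 /f mulr_sumr mulr_sumr -big_split/= ler_sum// => i _.
  have h2 := sqr_le_cosh (u x i); have h1 : d i 0 ^+ 2 <= `|d| ^+ 2.
    rewrite -(real_normK (num_real (d i 0))) lerXn2r ?nnegrE//.
    exact: coord_le_norm.
  have h3 : 0 <= expR (u x i) + expR (- u x i) - 2.
    by apply: le_trans h2; rewrite divr_ge0// sqr_ge0.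
  by have := ler_wpM2r h3 h1; lra.
- by rewrite f0E; apply: le_trans wd; apply: ler_sum => i _; rewrite u0.
- by rewrite f0E divergence_ge0.
- by apply: sumr_ge0 => i _; exact: sqr_ge0.
Qed.

(** Young's inequality absorbs half of |d|_2^2 and leaves |d|_2^2 <= sum_i (2 sinh w_i)^2. With g =
    2 cosh w_i - 2 <= G, (2 sinh w_i)^2 = g^2 + 4 g. *)
Lemma newton_dir_bound (R : realType) (m : nat) (w d : 'cV[R]_m) :
  \sum_i ((expR (w i 0) - expR (- w i 0)) * d i 0) <=
    - divergence w - \sum_i d i 0 ^+ 2 ->
  `|d| ^+ 2 <= m%:R * (divergence w ^+ 2 + 4 * divergence w).
Proof.
move=> wd; have G0 := divergence_ge0 w; set G := divergence w in wd G0 *.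
have sinhG i : (expR (w i 0) - expR (- w i 0)) ^+ 2 <= G ^+ 2 + 4 * G.
  have := divergence_ge_coord w i; rewrite -/G.
  have := sqr_le_cosh (w i 0); have := sqr_ge0 (w i 0).
  have : expR (w i 0) * expR (- w i 0) = 1 by rewrite -expRD subrr expR0.
  move: (expR _) (expR _) => e a ae1 h1 h2 h3.
  have g0 : 0 <= a + e - 2 by lra.
  have : (a + e - 2) ^+ 2 <= G ^+ 2 by rewrite lerXn2r ?nnegrE.
  by rewrite !expr2; nra.
apply: col_norm_sq_le => [|i].
  by rewrite mulr_ge0 ?addr_ge0 ?sqr_ge0 ?mulr_ge0.
have dle : d i 0 ^+ 2 <= \sum_j d j 0 ^+ 2.
  by rewrite (bigD1 i)//= lerDl sumr_ge0// => j _; exact: sqr_ge0.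
apply: (le_trans dle).
have sumle : \sum_j (expR (w j 0) - expR (- w j 0)) ^+ 2 <=
    m%:R * (G ^+ 2 + 4 * G).
  rewrite mulr_natl -[X in _ *+ X]card_ord -sumr_const; exact: ler_sum.
apply: le_trans sumle.
have amgm : - \sum_j ((expR (w j 0) - expR (- w j 0)) * d j 0) <=
    2^-1 * \sum_j d j 0 ^+ 2 +
    2^-1 * \sum_j (expR (w j 0) - expR (- w j 0)) ^+ 2.
  rewrite -sumrN !mulr_sumr -big_split/= ler_sum// => j _.
  move: (expR _ - _) (d j 0) => a e.
  by have := sqr_ge0 (a + e); rewrite !expr2; lra.
lra.
Qed.

(** * Existence of the Newton direction *)

(** On a kernel vector the W-form and the weighted squares of A u sum to zero; both are nonnegative,
    hence zero, so the form of A^T A + W vanishes there too. *)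
Lemma weighted_gram_unitmx (R : realType) (m n : nat) (A : 'M[R]_(m, n))
    (W : 'M[R]_n) (D : 'rV[R]_m) :
  psd W -> posdef (A^T *m A + W) -> (forall i, 0 < D 0 i) ->
  W + A^T *m diag_mx D *m A \in unitmx.
Proof.
move=> [_ W0] [_ pd] D0; rewrite -row_free_unit; apply: inj_row_free => u uH.
have sqE : u *m (A^T *m diag_mx D *m A) *m u^T =
    ((\sum_i D 0 i * (A *m u^T) i 0 ^+ 2)%:M).
  rewrite -!mulmxA; apply/matrixP => i j; rewrite !ord1 [RHS]mxE eqxx mulr1n.
  rewrite mulmxA -[u *m A^T]trmxK trmx_mul trmxK mxE; apply: eq_bigr => k _.
  by rewrite mul_diag_mx !mxE; ring.
have quadE : quadform W u^T + \sum_i D 0 i * (A *m u^T) i 0 ^+ 2 = 0.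
  have := congr1 (fun M => (M *m u^T) 0 0) uH; rewrite mulmxDr mulmxDl sqE.
  by rewrite mul0mx /quadform trmxK !mxE eqxx mulr1n.
have sum0 : 0 <= \sum_i D 0 i * (A *m u^T) i 0 ^+ 2.
  by apply: sumr_ge0 => i _; rewrite mulr_ge0 ?sqr_ge0// ltW.
have Wu0 : quadform W u^T = 0 by have := W0 u^T; lra.
have Au0 : A *m u^T = 0.
  apply/colP => i; rewrite [RHS]mxE; apply/eqP; rewrite -sqrf_eq0.
  have := quadE; rewrite Wu0 add0r => /psumr_eq0P.
  move=> /(_ (fun i _ => mulr_ge0 (ltW (D0 i)) (sqr_ge0 _)) i isT)/eqP.
  by rewrite mulf_eq0 gt_eqF.
apply/trmx_inj; rewrite trmx0; apply/eqP; apply: contraT => /pd.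
rewrite /quadform mulmxDr mulmxDl mxE -/(quadform W u^T) Wu0 addr0.
by rewrite -!mulmxA Au0 !mulmx0 mxE ltxx.
Qed.

(** The second Newton equation expresses d through x; inserting this into the first leaves the
    linear system in x with matrix [H]. *)
Lemma newton_dir_exists (R : realType) (m n : nat) (A : 'M[R]_(m, n))
    (b : 'cV[R]_m) (c : 'cV[R]_n) (W : 'M[R]_n) (mu : R) (v : 'cV[R]_m) :
  psd W -> posdef (A^T *m A + W) -> 0 < mu ->
  exists d, is_newton_dir A b c W mu v d.
Proof.
move=> Wpsd pd mu0; have s0 : 0 < Num.sqrt mu by rewrite sqrtr_gt0.
set s := Num.sqrt mu in s0 *.
pose D : 'rV[R]_m := \row_i expR (v i 0) ^+ 2.
pose H := W + A^T *m diag_mx D *m A.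
have Hu : H \in unitmx.
  by apply: weighted_gram_unitmx => // i; rewrite mxE exprn_gt0 ?expR_gt0.
have [x] : exists x, H *m x =
    (2 * s) *: (A^T *m expv v) - A^T *m diag_mx D *m b - c.
  by eexists; exact: mulKVmx.
rewrite mulmxDl => Hx.
exists (\col_i (1 - expR (v i 0) * (A *m x + b) i 0 / s)); exists x.
set d := \col_i _; split; rewrite -/s.
  have -> : s *: (A^T *m (expv v + hadamard (expv v) d)) =
      A^T *m ((2 * s) *: expv v - diag_mx D *m (A *m x + b)).
    rewrite scalemxAr; congr (_ *m _); apply/colP => i.
    rewrite mul_diag_mx !mxE; move: (\sum_j _) => y; field.
    by rewrite gt_eqF.
  rewrite mulmxBr -scalemxAr 2!mulmxDr !mulmxA.
  move/(canRL (addrK _)): Hx => ->.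
  by apply/colP => i; rewrite !mxE; ring.
apply/colP => i; rewrite !mxE expRN; move: (\sum_j _) => y; field.
by rewrite !gt_eqF ?expR_gt0.
Qed.

(** * Existence of the centered point *)

Definition qp_objective (R : realType) (n : nat) (c : 'cV[R]_n) (W : 'M[R]_n)
  (x : 'cV[R]_n) : R := 2^-1 * quadform W x + (c^T *m x) 0 0.

(* exp(- B / mu) for the logarithmic barrier function
   B x := q x - mu sum_i ln (A x + b)_i. *)
Definition exp_barrier (R : realType) (m n : nat) (A : 'M[R]_(m, n))
    (b : 'cV[R]_m) (c : 'cV[R]_n) (W : 'M[R]_n) (mu : R) (x : 'cV[R]_n) : R :=
  expR (- (qp_objective c W x / mu)) * \prod_i (A *m x + b) i 0.

Lemma qp_objective_line (R : realType) (n : nat) (c : 'cV[R]_n) (W : 'M[R]_n)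
    (x h : 'cV[R]_n) (t : R) : W^T = W ->
  qp_objective c W (x + t *: h) =
  qp_objective c W x + t * ((W *m x + c)^T *m h) 0 0 +
  t ^+ 2 / 2 * quadform W h.
Proof.
move=> Wsym; have sym : x^T *m W *m h = h^T *m W *m x.
  have <- : (x^T *m W *m h)^T = h^T *m W *m x.
    by rewrite !trmx_mul trmxK Wsym mulmxA.
  by apply/matrixP => i j; rewrite [RHS]mxE !ord1.
rewrite /qp_objective /quadform !linearD/= !linearZ/= !mulmxDl.
rewrite trmx_mul Wsym -!scalemxAl sym.
move: (x^T *m W *m x) (h^T *m W *m x) (h^T *m W *m h) (c^T *m h) (c^T *m x).
by move=> p1 p2 p3 p4 p5; rewrite !mxE; field.
Qed.

(** On the segment from x0 to x, the point at distance rho from x0 is outside the bounded sublevel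
    set, so the objective has risen by more than 1 there; convexity extrapolates this rise to x. *)
Lemma qp_objective_linear_growth (R : realType) (m n : nat) (A : 'M[R]_(m, n))
    (b : 'cV[R]_m) (c : 'cV[R]_n) (W : 'M[R]_n) (x0 : 'cV[R]_n) :
  psd W -> strictly_feasible A b x0 ->
  bounded_set (qp_sublevel A b c W (qp_objective c W x0 + 1)) ->
  exists2 rho : R, 0 < rho & forall x, (forall i, 0 <= (A *m x + b) i 0) ->
    rho <= `|x - x0| ->
    qp_objective c W x0 + `|x - x0| / rho <= qp_objective c W x.
Proof.
move=> [Wsym W0] fx0 /ex_strict_bound_gt0[M M0 bnd].
have rho0 : 0 < M + `|x0| by rewrite ltr_pwDl.
exists (M + `|x0|) => // x fx; set rho := M + `|x0| in rho0 *.
set h := x - x0 => rhoh; have h0 : 0 < `|h| by apply: lt_le_trans rhoh.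
have xE : x = x0 + 1 *: h by rewrite scale1r addrCA subrr addr0.
clearbody h.
(* This scaling puts x0 + tau h at distance rho from x0, hence at norm at least M. *)
set tau := rho / `|h|; have tau0 : 0 < tau by rewrite divr_gt0.
have tau1 : tau <= 1 by rewrite ler_pdivrMr// mul1r.
have obj_y : qp_objective c W x0 + 1 < qp_objective c W (x0 + tau *: h).
  rewrite ltNge; apply/negP => obj_y.
  have /bnd : qp_sublevel A b c W (qp_objective c W x0 + 1) (x0 + tau *: h).
    split=> // i; have := fx0 i; have : 0 <= (A *m (x0 + h) + b) i 0.
      by rewrite -[h]scale1r -xE.
    rewrite !mulmxDr -!scalemxAr.
    move: (A *m x0) (A *m h) => p1 p2; rewrite !mxE => h1 h2.
    have := mulr_ge0 (ltW tau0) h1.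
    have : 0 <= (1 - tau) * (p1 i 0 + b i 0).
      by rewrite mulr_ge0 ?subr_ge0 ?(ltW h2).
    lra.
  rewrite /= ltNge => /negP; apply.
  have : `|tau *: h| <= `|x0 + tau *: h| + `|x0|.
    by rewrite -[X in `|X| <= _](addKr x0) addrC
      (le_trans (ler_normD _ _))// normrN.
  by rewrite normrZ gtr0_norm// divfK ?gt_eqF// lerD2r.
have := qp_objective_line c x0 h 1 Wsym; rewrite -xE => ->.
move: obj_y; rewrite qp_objective_line//.
move: (qp_objective _ _ _) (((_)^T *m h) 0 0) (W0 h) => o l Q0.
have -> : `|h| / rho = tau^-1 by rewrite invf_div.
move=> H; have tauQ : tau * (tau * quadform W h) <= tau * (1 * quadform W h).
  by rewrite ler_pM2l// ler_wpM2r.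
have {H tauQ} : 1 <= tau * (l + quadform W h / 2) by rewrite expr2 in H; lra.
by rewrite -ler_pdivrMl// mulr1 => H; lra.
Qed.

(** Multiply the bounds e y_i <= exp (e y_i). The rate e stays free, so that it can be taken smaller
    than the decay rate of the other factor of the barrier. *)
Lemma prod_le_expR_sum (R : realType) (m : nat) (y : 'I_m -> R) (e : R) :
  0 < e -> (forall i, 0 <= y i) ->
  \prod_i y i <= e ^- m * expR (e * \sum_i y i).
Proof.
move=> e0 y0; rewrite mulr_sumr expR_sum -[e ^- m]exprVn.
rewrite -[X in _ ^+ X]card_ord -prodr_const -big_split/=.
apply: ler_prod => i _; rewrite y0/= ler_pdivlMl//.
by apply: le_trans (expR_ge1Dx _); rewrite lerDr.
Qed.

Lemma slack_sum_growth (R : realType) (m n : nat) (A : 'M[R]_(m, n))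
    (b : 'cV[R]_m) (x0 x : 'cV[R]_n) :
  \sum_i (A *m x + b) i 0 <=
  \sum_i (A *m x0 + b) i 0 + (\sum_i \sum_j `|A i j|) * `|x - x0|.
Proof.
rewrite mulr_suml -big_split/= ler_sum// => i _.
rewrite -lerBlDl (_ : _ - _ = (A *m (x - x0)) i 0); last first.
  by rewrite mulmxBr; move: (A *m x) (A *m x0) => p1 p2; rewrite !mxE; ring.
rewrite mxE mulr_suml ler_sum// => j _; apply: le_trans (ler_norm _) _.
by rewrite normrM ler_wpM2l// coord_le_norm.
Qed.

Lemma exp_barrier_coercive (R : realType) (m n : nat) (A : 'M[R]_(m, n))
    (b : 'cV[R]_m) (c : 'cV[R]_n) (W : 'M[R]_n) (mu : R) (x0 : 'cV[R]_n) :
  psd W -> strictly_feasible A b x0 ->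
  bounded_set (qp_sublevel A b c W (qp_objective c W x0 + 1)) -> 0 < mu ->
  exists r : R, forall x, (forall i, 0 <= (A *m x + b) i 0) ->
    r <= `|x - x0| ->
    exp_barrier A b c W mu x < exp_barrier A b c W mu x0.
Proof.
move=> Wpsd fx0 bnd mu0.
have [rho rho0 growth] := qp_objective_linear_growth Wpsd fx0 bnd.
set B0 := exp_barrier _ _ _ _ _ x0.
have B0_gt0 : 0 < B0 by rewrite mulr_gt0 ?expR_gt0// prodr_gt0.
pose K := \sum_i \sum_j `|A i j|.
have K0 : 0 <= K by apply: sumr_ge0 => i _; apply: sumr_ge0.
pose S := \sum_i (A *m x0 + b) i 0.
(* With this e, the factor bounding the slacks grows at most at half the rate
   at which [expR (- q / mu)] decays. *)
pose e := (2 * rho * mu * (K + 1))^-1.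
have rm0 : 0 < 2 * rho * mu by rewrite !mulr_gt0.
have e0 : 0 < e by rewrite invr_gt0 mulr_gt0// ltr_wpDl.
have eK : e * K <= (2 * rho * mu)^-1.
  have -> : e * K = (2 * rho * mu)^-1 * (K / (K + 1)).
    by rewrite /e; field; rewrite !gt_eqF// ltr_wpDl.
  rewrite ler_piMr ?invr_ge0 ?(ltW rm0)//.
  by rewrite ler_pdivrMr ?ltr_wpDl// mul1r lerDl.
pose q0 := qp_objective c W x0.
pose C := e ^- m * expR (e * S - q0 / mu).
have C0 : 0 < C by rewrite mulr_gt0 ?expR_gt0// invr_gt0 exprn_gt0.
(* Beyond rho the linear growth applies and gives the bound C exp (- z); the second entry forces z
   >= C / B0, so exp z > C / B0. *)
exists (Num.max rho (2 * rho * mu * (C / B0))) => x fx.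
rewrite ge_max => /andP[rho_r big_r]; set r := `|x - x0| in rho_r big_r.
set z := r / (2 * rho * mu).
have zbig : C / B0 <= z by rewrite ler_pdivlMr// mulrC.
apply: (@le_lt_trans _ _ (C * expR (- z))); last first.
  rewrite expRN ltr_pdivrMr ?expR_gt0// mulrC -ltr_pdivrMr//.
  apply: lt_le_trans (expR_ge1Dx _); rewrite ltr_pwDl//.
have prodle := prod_le_expR_sum e0 fx.
apply: (@le_trans _ _ (expR (- (qp_objective c W x / mu)) *
    (e ^- m * expR (e * \sum_i (A *m x + b) i 0)))).
  by rewrite ler_wpM2l// expR_ge0.
rewrite /C mulrCA -mulrA ler_wpM2l ?invr_ge0 ?exprn_ge0 ?(ltW e0)//.
rewrite -!expRD ler_expR.
have sumle := slack_sum_growth A b x0 x; rewrite -/K -/S -/r in sumle.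
have := ler_wpM2l (ltW e0) sumle.
have := ler_wpM2r (normr_ge0 (x - x0)) eK; rewrite -/r.
have /(ler_wpM2r (ltW _)) : q0 + r / rho <= qp_objective c W x by exact: growth.
move=> /(_ mu^-1); rewrite invr_gt0 mu0 => /(_ isT).
have -> : (q0 + r / rho) / mu = q0 / mu + 2 * z.
  by rewrite /z; field; rewrite !gt_eqF.
by rewrite [_^-1 * r]mulrC -/z; lra.
Qed.

(** Inverting 1 - u / (1 + u) <= exp (- u / (1 + u)) gives exp (u / (1 + u)) <= 1 + u, and u - 2 u^2
    <= u / (1 + u) amounts to u^2 (1 + 2 u) >= 0. *)
Lemma expR_le_1Dx (R : realType) (u : R) :
  - 2^-1 <= u -> expR (u - 2 * u ^+ 2) <= 1 + u.
Proof.
move=> u2; have u1 : 0 < 1 + u by lra.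
have : expR (u / (1 + u)) <= 1 + u.
  rewrite -[leRHS]invrK -lef_pV2 ?posrE ?expR_gt0 ?invr_gt0// invrK -expRN.
  apply: le_trans (expR_ge1Dx _); rewrite le_eqVlt; apply/orP; left; apply/eqP.
  by field; rewrite gt_eqF.
apply: le_trans; rewrite ler_expR ler_pdivlMr//.
have : 0 <= u ^+ 2 * (1 + 2 * u) by rewrite mulr_ge0 ?sqr_ge0//; lra.
by rewrite !expr2; nra.
Qed.

(* Otherwise a step t h with t small enough would increase the barrier, by the
   second-order estimate [1 + u >= exp (u - 2 u^2)] applied to each slack. *)
Lemma exp_barrier_max_gradient_le (R : realType) (m n : nat)
    (A : 'M[R]_(m, n)) (b : 'cV[R]_m) (c : 'cV[R]_n) (W : 'M[R]_n) (mu : R)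
    (x h : 'cV[R]_n) :
  psd W -> 0 < mu -> strictly_feasible A b x ->
  (forall y, strictly_feasible A b y ->
    exp_barrier A b c W mu y <= exp_barrier A b c W mu x) ->
  mu * \sum_i (A *m h) i 0 / (A *m x + b) i 0 <= ((W *m x + c)^T *m h) 0 0.
Proof.
move=> [Wsym W0] mu0 fx xmax; rewrite leNgt; apply/negP => lt.
set L := ((_)^T *m h) 0 0 in lt.
pose z i := (A *m h) i 0 / (A *m x + b) i 0.
pose a := \sum_i z i - L / mu.
have a0 : 0 < a by rewrite subr_gt0 ltr_pdivrMr// mulrC.
pose k := quadform W h / (2 * mu) + 2 * \sum_i z i ^+ 2.
have sq0 : 0 <= \sum_i z i ^+ 2 by apply: sumr_ge0 => i _; exact: sqr_ge0.
have k0 : 0 <= k.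
  by rewrite addr_ge0 ?mulr_ge0// ?invr_ge0 ?mulr_ge0 ?(ltW mu0).
pose Z := \sum_i `|z i|; have Z0 : 0 <= Z by exact: sumr_ge0.
have den0 : 0 < 2 * (k + a * Z + a).
  by rewrite mulr_gt0// ltr_wpDl// addr_ge0// mulr_ge0// ltW.
(* The logarithm of the barrier gains at least t a - t^2 k. This t ensures both t k < a and t Z <=
   1/2, the latter keeping each t z_i in the range of [expR_le_1Dx]. *)
pose t := a / (2 * (k + a * Z + a)); have t0 : 0 < t by rewrite divr_gt0.
have tz i : `|t * z i| <= 2^-1.
  rewrite normrM gtr0_norm//.
  apply: (@le_trans _ _ (t * Z)).
    by rewrite ler_pM2l// /Z (bigD1 i)//= lerDl sumr_ge0.
  by rewrite /t mulrAC ler_pdivrMr//; lra.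
have tk : t * k < a.
  rewrite /t mulrAC ltr_pdivrMr// ltr_pM2l//.
  by have := mulr_ge0 (ltW a0) Z0; lra.
have slackE i : (A *m (x + t *: h) + b) i 0 = (A *m x + b) i 0 * (1 + t * z i).
  rewrite /z mulmxDr -scalemxAr; have := fx i.
  move: (A *m x) (A *m h) => p1 p2; rewrite !mxE => p1b.
  by field; rewrite gt_eqF.
have tz1 i : - 2^-1 <= t * z i by have := tz i; rewrite ler_norml => /andP[].
have fy : strictly_feasible A b (x + t *: h).
  by move=> i; rewrite slackE mulr_gt0//; have := tz1 i; lra.
have := xmax _ fy; rewrite leNgt => /negP; apply.
rewrite /exp_barrier qp_objective_line// -/L.
under [X in _ < _ * X]eq_bigr do rewrite slackE.
rewrite big_split/= [ltLHS]mulrC [ltRHS]mulrCA [X in _ < _ * X]mulrC.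
rewrite ltr_pM2l ?prodr_gt0//.
have prodge : expR (t * \sum_i z i - 2 * (t ^+ 2 * \sum_i z i ^+ 2)) <=
    \prod_i (1 + t * z i).
  rewrite !mulr_sumr -sumrN -big_split/= expR_sum ler_prod// => i _.
  by rewrite expR_ge0/= -exprMn; exact: expR_le_1Dx.
apply: lt_le_trans (ler_wpM2r (expR_ge0 _) prodge).
rewrite -expRD ltr_expR.
have ta : t * (t * k) < t * a by rewrite ltr_pM2l.
have muV (y : R) : y / (2 * mu) = y / mu / 2 by field; rewrite gt_eqF.
rewrite /a /k muV in ta; move: (\sum_i z i) (\sum_i z i ^+ 2) ta => s1 s2.
by rewrite !expr2; lra.
Qed.

(** The directional inequality at a unit vector and at its negative gives equality in each
    coordinate. *)
Lemma exp_barrier_max_gradient (R : realType) (m n : nat)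
    (A : 'M[R]_(m, n)) (b : 'cV[R]_m) (c : 'cV[R]_n) (W : 'M[R]_n) (mu : R)
    (x : 'cV[R]_n) :
  psd W -> 0 < mu -> strictly_feasible A b x ->
  (forall y, strictly_feasible A b y ->
    exp_barrier A b c W mu y <= exp_barrier A b c W mu x) ->
  W *m x + c = mu *: (A^T *m \col_i ((A *m x + b) i 0)^-1).
Proof.
move=> Wpsd mu0 fx xmax.
have le := fun h => exp_barrier_max_gradient_le h Wpsd mu0 fx xmax.
apply/colP => j.
have -> : (W *m x + c) j 0 = ((W *m x + c)^T *m delta_mx j (0 : 'I_1)) 0 0.
  by rewrite -colE !mxE.
have -> : (mu *: (A^T *m \col_i ((A *m x + b) i 0)^-1)) j 0 =
    mu * \sum_i (A *m delta_mx j (0 : 'I_1)) i 0 / (A *m x + b) i 0.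
  rewrite [LHS]mxE [X in _ * X]mxE; congr (_ * _); apply: eq_bigr => i _.
  by rewrite -colE [(\col__ _) _ _]mxE !mxE.
apply/eqP; rewrite eq_le le andbT -lerN2.
have := le (- delta_mx j (0 : 'I_1)); rewrite !mulmxN [leRHS]mxE.
apply: le_trans.
rewrite -mulrN -sumrN ler_wpM2l ?(ltW mu0)// ler_sum// => i _.
by rewrite [X in _ <= X / _]mxE mulNr.
Qed.

(* Truncating the slacks at 0 makes the function vanish at every point that is
   not strictly feasible, so it can be maximized over a box.  Row vectors are
   used because [rV_compact] is stated for them. *)
Lemma truncated_exp_barrier_continuous (R : realType) (m n : nat)
    (A : 'M[R]_(m, n)) (b : 'cV[R]_m) (c : 'cV[R]_n) (W : 'M[R]_n) (mu : R) :
  continuous (fun u : 'rV[R]_n => expR (- (qp_objective c W u^T / mu)) *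
    \prod_i Num.max 0 ((A *m u^T + b) i 0)).
Proof.
have coord j : continuous (fun u : 'rV[R]_n => u^T j 0).
  have -> : (fun u : 'rV[R]_n => u^T j 0) = (fun u => u 0 j).
    by apply/funext => u; rewrite mxE.
  exact: coord_continuous.
have lin (p : nat) (M : 'M[R]_(p, n)) i :
    continuous (fun u : 'rV[R]_n => (M *m u^T) i 0).
  have -> : (fun u : 'rV[R]_n => (M *m u^T) i 0) =
      (fun u => \sum_j M i j * u^T j 0) by apply/funext => u; rewrite mxE.
  apply: continuous_big => [|j _ u]; first exact: add_continuous.
  by apply: continuousM; [exact: cst_continuous|exact: coord].
have quad : continuous (fun u : 'rV[R]_n => quadform W u^T).
  have -> : (fun u : 'rV[R]_n => quadform W u^T) =
      (fun u => \sum_j u^T j 0 * (W *m u^T) j 0).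
    apply/funext => w; rewrite /quadform -mulmxA mxE.
    by apply: eq_bigr => j _; rewrite mxE.
  apply: continuous_big => [|j _ w]; first exact: add_continuous.
  by apply: continuousM; [exact: coord|exact: lin].
have half_quad : continuous (fun u : 'rV[R]_n => 2^-1 * quadform W u^T).
  by move=> u; exact: (continuousM (@cst_continuous _ _ (2^-1 : R) u) (quad u)).
have obj : continuous (fun u : 'rV[R]_n => qp_objective c W u^T).
  by move=> u; exact: (continuousD (half_quad u) (lin _ c^T 0 u)).
have objV : continuous (fun u : 'rV[R]_n => qp_objective c W u^T / mu).
  by move=> u; exact: (continuousM (obj u) (@cst_continuous _ _ mu^-1 u)).
have slack i : continuous (fun u : 'rV[R]_n => (A *m u^T + b) i 0).
  have -> : (fun u : 'rV[R]_n => (A *m u^T + b) i 0) =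
      (fun u => (A *m u^T) i 0) + (fun=> b i 0).
    by apply/funext => w; rewrite mxE.
  move=> u.
  exact: (continuousD (lin _ A i u) (@cst_continuous _ _ (b i 0) u)).
have prod : continuous (fun u : 'rV[R]_n =>
    \prod_i Num.max 0 ((A *m u^T + b) i 0)).
  apply: continuous_big => [|i _ u]; first exact: mul_continuous.
  exact: (continuous_max (@cst_continuous _ _ 0 u) (slack i u)).
have expq : continuous (fun u : 'rV[R]_n =>
    expR (- (qp_objective c W u^T / mu))).
  move=> u.
  exact: (continuous_comp (continuousN (objV u)) (@continuous_expR R _)).
by move=> u; exact: (continuousM (expq u) (prod u)).
Qed.

(** Maximize the truncated barrier over a compact box. Its positive value at x0 forces the maximizer
    to be strictly feasible, and coercivity handles points outside the box. *)
Lemma exp_barrier_max_exists (R : realType) (m n : nat) (A : 'M[R]_(m, n))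
    (b : 'cV[R]_m) (c : 'cV[R]_n) (W : 'M[R]_n) (mu : R) :
  psd W -> (exists x, strictly_feasible A b x) ->
  (forall gamma : R, bounded_set (qp_sublevel A b c W gamma)) -> 0 < mu ->
  exists2 x, strictly_feasible A b x & forall y, strictly_feasible A b y ->
    exp_barrier A b c W mu y <= exp_barrier A b c W mu x.
Proof.
move=> Wpsd [x0 fx0] bnd mu0.
have [r coer] := exp_barrier_coercive Wpsd fx0 (bnd _) mu0.
(* If |y| > M then |y - x0| > r; the absolute value of r, whose sign is unknown, keeps x0 in the
   box. *)
pose M := `|x0| + `|r|.
pose box := [set u : 'rV[R]_n | forall j, `[(- M), M]%classic (u ord0 j)].
pose f (u : 'rV[R]_n) := expR (- (qp_objective c W u^T / mu)) *
    \prod_i Num.max 0 ((A *m u^T + b) i 0).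
have fE x : strictly_feasible A b x -> f x^T = exp_barrier A b c W mu x.
  move=> fx; rewrite /f trmxK; congr (_ * _); apply: eq_bigr => i _.
  by rewrite max_r// ltW.
have boxP x : `|x| <= M -> box x^T.
  move=> xM j; rewrite /= in_itv/= -ler_norml mxE.
  exact: le_trans (coord_le_norm _ _) xM.
have box_x0 : box x0^T by apply: boxP; rewrite lerDl.
have cbox : compact box.
  apply: (@rV_compact _ _ (fun=> `[- M, M]%classic)) => _.
  exact: segment_compact.
have cf : {within box, continuous f}.
  exact/continuous_subspaceT/truncated_exp_barrier_continuous.
have [u _ umax] := compact_EVT_max (ex_intro _ _ box_x0) cbox cf.
have feasible_u : strictly_feasible A b u^T.
  move=> i; rewrite ltNge; apply/negP => le0.
  have := umax x0^T (mem_set box_x0); rewrite fE// leNgt => /negP; apply.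
  rewrite /f (bigD1 i)//= max_l// mul0r mulr0 mulr_gt0 ?expR_gt0//.
  by rewrite prodr_gt0.
exists u^T => // y fy; rewrite -!fE// trmxK.
have [yM|My] := leP `|y| M; first exact/umax/mem_set/boxP.
apply: le_trans (umax _ (mem_set box_x0)); rewrite !fE// ltW//.
apply: coer => [i|]; first exact/ltW/fy.
have : `|y| <= `|y - x0| + `|x0| by rewrite -{1}(subrK x0 y) ler_normD.
by have := ler_norm r; rewrite /M in My; lra.
Qed.

Lemma centered_point_exists (R : realType) (m n : nat) (A : 'M[R]_(m, n))
    (b : 'cV[R]_m) (c : 'cV[R]_n) (W : 'M[R]_n) (mu : R) :
  psd W -> (exists x, strictly_feasible A b x) ->
  (forall gamma : R, bounded_set (qp_sublevel A b c W gamma)) ->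
  0 < mu -> exists v, is_centered A b c W mu v.
Proof.
move=> Wpsd feas bnd mu0.
have [x fx xmax] := exp_barrier_max_exists Wpsd feas bnd mu0.
have s0 : 0 < Num.sqrt mu by rewrite sqrtr_gt0.
(* The second centering equation forces v_i = - ln (y i); the first then becomes the stationarity
   condition at x. *)
pose y i := (A *m x + b) i 0 / Num.sqrt mu.
have y0 i : 0 < y i by rewrite divr_gt0// fx.
exists (\col_i - ln (y i)); exists x; split.
  rewrite (exp_barrier_max_gradient Wpsd mu0 fx xmax).
  rewrite -[X in _ = X *: _](sqr_sqrtr (ltW mu0)) expr2 -scalerA.
  congr (_ *: _).
  rewrite scalemxAr; congr (_ *m _); apply/colP => i.
  by rewrite [LHS]mxE mxE expRN lnK ?posrE// invf_div [RHS]mxE [in RHS]mxE.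
apply/colP => i.
rewrite [LHS]mxE [in LHS]mxE [X in expR X]mxE mxE opprK lnK ?posrE//.
by rewrite /y mulrC divfK ?gt_eqF.
Qed.

(** * Convergence *)

(** The damping depends on v, but [newton_dir_bound] bounds it in terms of K alone, which makes the
    contraction factor uniform. *)
Lemma newton_step_contraction (R : realType) (m n : nat) (A : 'M[R]_(m, n))
    (b : 'cV[R]_m) (c : 'cV[R]_n) (W : 'M[R]_n) (beta mu : R)
    (vh v : 'cV[R]_m) (K : R) :
  psd W -> posdef (A^T *m A + W) -> 0 < beta -> beta < 1 -> 0 < mu ->
  is_centered A b c W mu vh -> divergence (v - vh) <= K ->
  divergence (newton_step A b c W beta mu v - vh) <=
  (1 - (Num.max 1 ((2 * beta)^-1 * (m%:R * (K ^+ 2 + 4 * K))))^-1 *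
    (1 - beta)) * divergence (v - vh).
Proof.
move=> Wpsd pd beta0 beta1 mu0 cvh vK.
have dvec : is_newton_dir A b c W mu v (newton_dir A b c W v mu).
  exact: xgetPex (newton_dir_exists _ _ _ Wpsd pd mu0).
have ineq := newton_dir_inequality Wpsd mu0 cvh dvec.
rewrite /newton_step /newton_damping.
move: (newton_dir _ _ _ _ _ _) ineq => d ineq.
have bound := newton_dir_bound ineq.
set alpha := Num.max 1 ((2 * beta)^-1 * `|d| ^+ 2).
set alpha' := Num.max 1 _.
have alpha1 : 1 <= alpha by rewrite le_max lexx.
have alpha_gt0 : 0 < alpha by apply: lt_le_trans alpha1.
have G0 := divergence_ge0 (v - vh).
have alphaK : alpha <= alpha'.
  rewrite ge_max le_max lexx/= le_max; apply/orP; right.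
  rewrite ler_pM2l ?invr_gt0 ?mulr_gt0//; apply: (le_trans bound).
  rewrite ler_wpM2l// lerD ?ler_pM2l// lerXn2r ?nnegrE//.
  exact: le_trans vK.
rewrite addrAC.
apply: le_trans (divergence_damped_step (beta := beta) ineq _ _ _) _ => //.
- by rewrite invr_ge0 ltW// invf_le1.
- rewrite mulrC ler_pdivrMr// mulrC -ler_pdivrMr ?mulr_gt0// mulrC.
  by rewrite le_max lexx orbT.
- rewrite ler_wpM2r// lerD2l lerN2 ler_wpM2r ?subr_ge0 ?(ltW beta1)//.
  by rewrite lef_pV2 ?posrE// (lt_le_trans alpha_gt0).
Qed.

(** The potential never exceeds its initial value, so the contraction with K = G(v0) applies at
    every step with the same factor. *)
Lemma newton_iterates_divergence_geometric (R : realType) (m n : nat)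
    (A : 'M[R]_(m, n)) (b : 'cV[R]_m) (c : 'cV[R]_n) (W : 'M[R]_n)
    (beta mu : R) (vh v0 : 'cV[R]_m) :
  psd W -> posdef (A^T *m A + W) -> 0 < beta -> beta < 1 -> 0 < mu ->
  is_centered A b c W mu vh ->
  exists2 rho : R, 0 <= rho < 1 & forall i,
    divergence (newton_iterates A b c W beta mu v0 i - vh) <=
    rho ^+ i * divergence (v0 - vh).
Proof.
move=> Wpsd pd beta0 beta1 mu0 cvh; set G := divergence (v0 - vh).
have G0 : 0 <= G by exact: divergence_ge0.
set alpha := Num.max 1 ((2 * beta)^-1 * (m%:R * (G ^+ 2 + 4 * G))).
have alpha1 : 1 <= alpha by rewrite le_max lexx.
have ialpha : 0 < alpha^-1 <= 1.
  rewrite invr_gt0 (lt_le_trans _ alpha1)//=.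
  by rewrite invf_le1 ?(lt_le_trans _ alpha1).
exists (1 - alpha^-1 * (1 - beta)) => [|i].
  by move/andP: ialpha => [? ?]; apply/andP; split; nra.
set rho := 1 - _; have /andP[rho0 rho1] : 0 <= rho <= 1.
  by move/andP: ialpha => [? ?]; rewrite /rho; apply/andP; split; nra.
elim: i => [|i IH]; first by rewrite expr0 mul1r.
rewrite /newton_iterates iterS exprS -mulrA -/(newton_iterates _ _ _ _ _ _ _ i).
apply: le_trans (newton_step_contraction (K := G) _ _ _ _ _ cvh _) _ => //.
  by apply: (le_trans IH); rewrite ler_piMl// exprn_ile1.
by rewrite ler_wpM2l.
Qed.

Unset Implicit Arguments.

Theorem theorem2p3 (R : realType) (m n : nat)
  (A : 'M[R]_(m, n)) (b : 'cV[R]_m) (c : 'cV[R]_n) (W : 'M[R]_n)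
  (W_psd : psd W)
  (feasible : exists x : 'cV[R]_n, strictly_feasible A b x)
  (bounded_sublevel : forall gamma : R, bounded_set (qp_sublevel A b c W gamma))
  (AW_posdef : posdef (A^T *m A + W))
  (beta mu : R) (beta_gt0 : 0 < beta) (beta_lt1 : beta < 1) (mu_gt0 : 0 < mu)
  (v0 : 'cV[R]_m) :
  newton_iterates A b c W beta mu v0 i @[i --> \oo] -->
    centered_point A b c W mu.
Proof.
have cvh : is_centered A b c W mu (centered_point A b c W mu).
  apply: xgetPex.
  exact: (centered_point_exists W_psd feasible bounded_sublevel).
move: (centered_point A b c W mu) cvh => vh cvh.
have [rho /andP[rho0 rho1] Grho] := newton_iterates_divergence_geometric v0
  W_psd AW_posdef beta_gt0 beta_lt1 mu_gt0 cvh.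
(* Squares are compared: [sqr_le_cosh] bounds the squared distance by 4 G, so the geometric sequence
   has to fall below eps^2. *)
apply/cvgrPdist_le => eps eps0.
have := @cvg_geometric R (4 * divergence (v0 - vh)) rho.
rewrite ger0_norm// => /(_ rho1)/cvgrPdist_le/(_ _ (exprn_gt0 2 eps0)).
apply: filterS => i; rewrite sub0r normrN/= => small.
rewrite -(@ler_pXn2r _ 2)// ?nnegrE ?(ltW eps0)// distrC.
apply: le_trans small; apply: le_trans (ler_norm _).
have G0 j : 0 <= divergence (newton_iterates A b c W beta mu v0 j - vh).
  exact: divergence_ge0.
apply: le_trans
  (_ : 4 * divergence (newton_iterates A b c W beta mu v0 i - vh) <= _).
  apply: col_norm_sq_le => [|k]; first by rewrite mulr_ge0.
  rewrite mulrC -ler_pdivrMr//.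
  exact: le_trans (sqr_le_cosh _) (divergence_ge_coord _ _).
by rewrite -mulrA ler_pM2l// mulrC.
Qed.
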